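(* Let $n\ge 1$ and let $X \in \mathcal{SH}(2n,\mathbb{C})$ be a skew-Hamiltonian matrix. Then $X$ is similar to $-X$ (that is, $gXg^{-1}=-X$ for some $g\in\mathrm{GL}(2n,\mathbb{C})$) if and only if $X$ is similar to $-X$ via a symplectic involution, that is, there exists $h\in\mathrm{Sp}(2n,\mathbb{C})$ with $h^2=\mathrm{I}_{2n}$ and $hXh^{-1}=-X$.
   Context: Let $\mathrm{I}_n$ be the $n\times n$ identity matrix and $\mathrm{J}_{2n} = \begin{pmatrix} 0 & \mathrm{I}_n\\ -\mathrm{I}_n & 0\end{pmatrix}$. Set $\mathrm{Sp}(2n,\mathbb{C}) = \{ g \in \mathrm{GL}(2n,\mathbb{C}) \mid g^T \mathrm{J}_{2n} g = \mathrm{J}_{2n}\}$, and let $\mathcal{SH}(2n,\mathbb{C}) = \{X \in \mathrm{M}(2n,\mathbb{C}) \mid X^T \mathrm{J}_{2n} = \mathrm{J}_{2n}X\}$ be the set of skew-Hamiltonian matrices. *)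

(* Defs.v *)
From HB Require Import structures.
From mathcomp Require Import all_boot all_order all_algebra.
From mathcomp Require Import reals complex.

Set Implicit Arguments.
Unset Strict Implicit.
Unset Printing Implicit Defensive.

Import GRing.Theory.
Local Open Scope ring_scope.

(* 2n x 2n matrices are typed 'M_(n + n), which gives the 2 x 2 block
   decomposition without casts. *)
Definition Jmx (F : fieldType) (n : nat) : 'M[F]_(n + n) :=
  block_mx 0 1%:M (- 1%:M) 0.

Definition Sp (F : fieldType) (n : nat) : {pred 'M[F]_(n + n)} :=
  [pred g : 'M[F]_(n + n) |
    (g \in unitmx) && (g^T *m Jmx F n *m g == Jmx F n)].

Definition skewHamiltonian (F : fieldType) (n : nat) : {pred 'M[F]_(n + n)} :=
  [pred X : 'M[F]_(n + n) | X^T *m Jmx F n == Jmx F n *m X].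

Arguments Jmx : clear implicits.
Arguments Sp : clear implicits.
Arguments skewHamiltonian : clear implicits.

(* Main.v *)
(* Write [A* = J^-1 A^T J]; skew-Hamiltonian means [X* = X], symplectic means
   [g* g = 1]. If [g X = - X g], then [h = g (g* g)^(-1/2)] is symplectic and still
   anticommutes with [X], but it need not be an involution. Split the space, by
   idempotents that are polynomials in [X^2], into the part where [X] is nilpotent
   and the part where it is invertible. On the invertible part
   [f = X (X^2)^(-1/2)] satisfies [f^2 = 1] and anticommutes with [h], so [h] exchanges
   the eigenspaces of [f], and [h] on one and [h^-1] on the other form a symplectic
   involution. On the nilpotent part every self-adjoint [X] is negated by a
   symplectic involution: a longest Jordan block is isotropic, hence dual to a
   second one of the same length; the two split off, and the signs [(-1)^i] along
   them do the job. *)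
Require Import Defs.
From HB Require Import structures.
From mathcomp Require Import all_boot all_order all_algebra.
From mathcomp Require Import reals complex.
From mathcomp Require Import ring.

Set Implicit Arguments.
Unset Strict Implicit.
Unset Printing Implicit Defensive.

Import GRing.Theory.
Local Open Scope ring_scope.
Local Open Scope complex_scope.

(** * Inverse square roots of the variable modulo a polynomial *)

Section InverseSquareRoot.
Variable F : closedFieldType.
Hypothesis two_neq0 : (2%:R : F) != 0.

Lemma quadratic_root (a b c : F) :
  (c != 0) || (b != 0) -> exists x, a + b * x + c * x ^+ 2 = 0.
Proof.
have [-> /= b0|c0 _] := eqVneq c 0.
  by exists (- a / b); field.
have [x] := @solve_monicpoly F 2
  (fun i => if i == 0%N then - (a / c) else - (b / c)) isT.
rewrite big_ord_recl big_ord1 /= expr0 mulr1 expr1 => hx.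
by exists x; rewrite hx; field.
Qed.

(* Adding one root [a] to [q], a square root [t] modulo [q] is corrected to
   [t + c q]; the condition at [a] is an equation of degree 2 or 1 in [c]. *)
Lemma inverse_sqrt_mod (p : {poly F}) :
  ~~ root p 0 -> exists t, p %| 'X * t ^+ 2 - 1.
Proof.
have [rs ->] := closed_field_poly_normal p.
have [->|lc0] := eqVneq (lead_coef p) 0; first by rewrite scale0r root0.
rewrite rootZ // => /negP p0.
suff [t ht] : exists t, \prod_(z <- rs) ('X - z%:P) %| 'X * t ^+ 2 - 1.
  by exists t; rewrite dvdpZl.
elim: rs p0 => [|a rs IH] p0.
  by exists 0; rewrite big_nil dvd1p.
move: p0; rewrite big_cons rootM root_XsubC; set q := \prod_(_ <- _) _ => p0.
have {IH} [|t /dvdpP[r hr]] := IH; first by move=> q0; apply: p0; rewrite q0 orbT.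
have a0 : a != 0 by apply/eqP=> a0; apply: p0; rewrite a0 eqxx.
have [|c hc] := @quadratic_root r.[a] (a * t.[a] *+ 2) (a * q.[a]).
  (* If [q.[a] = 0] the equation for [c] is linear with slope [2 a t(a)], nonzero because
     [a t(a)^2 = 1] at a root [a] of [q]. *)
  have [qa|qa] := eqVneq q.[a] 0; last by rewrite mulf_neq0.
  apply/orP; right; rewrite -mulr_natl !mulf_neq0 //.
  have := congr1 (horner^~ a) hr.
  rewrite hornerM qa mulr0 hornerD hornerN hornerM horner_exp hornerX hornerC.
  move/eqP; apply: contraTneq => ->.
  by rewrite expr0n mulr0 sub0r oppr_eq0 oner_neq0.
exists (t + c%:P * q).
have -> : 'X * (t + c%:P * q) ^+ 2 - 1
    = (r + ('X * t * c%:P) *+ 2 + 'X * q * c%:P ^+ 2) * q.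
  have hq : 'X * t ^+ 2 - 1 = r * q by [].
  transitivity ('X * t ^+ 2 - 1 + (('X * t * c%:P) *+ 2 + 'X * q * c%:P ^+ 2) * q).
    by ring.
  by rewrite hq; ring.
apply: dvdp_mul => //; rewrite dvdp_XsubCl /root.
rewrite !(hornerD, hornerMn, hornerM, horner_exp, hornerX, hornerC).
by apply/eqP; rewrite -[RHS]hc; ring.
Qed.
End InverseSquareRoot.

(** * Operators acting diagonally along a Jordan string *)

Section Strings.
Variables (F : comNzRingType) (R : algType F) (N : R) (k : nat).

(** For [A] of rank one, a vector [u] times a functional that sends [N^j u] to 1 if [j = k] and to 0
    otherwise, this operator multiplies [N^i u] by [s^i] for [i <= k]. *)
Definition string_sum (s : F) (A : R) : R :=
  \sum_(i < k.+1) s ^+ i *: (N ^+ i * A * N ^+ (k - i)).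

(** In the product of terms [i] and [j] the middle exponent is [k - i + j], so only [j = i]
    survives. *)
Lemma string_sumM (s s' : F) (A B C : R) :
    (forall j, A * N ^+ j * B = if j == k then C else 0) ->
  string_sum s A * string_sum s' B = string_sum (s * s') C.
Proof.
move=> hAB; rewrite /string_sum mulr_suml; apply: eq_bigr => i _.
have ik : (i <= k)%N by rewrite -ltnS.
have shape (j : 'I_k.+1) :
    N ^+ i * A * N ^+ (k - i) * (N ^+ j * B * N ^+ (k - j)) =
    N ^+ i * (A * N ^+ (k - i + j) * B) * N ^+ (k - j).
  by rewrite exprD !mulrA.
rewrite mulr_sumr (bigD1 i) //= big1 ?addr0 => [|j ji].
  by rewrite -scalerAl -scalerAr shape subnK // hAB eqxx scalerA exprMn.
rewrite -scalerAl -scalerAr shape hAB ifN ?mulr0 ?mul0r ?scaler0 //.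
apply: contraNneq ji => h; apply/eqP/val_inj/eqP => /=.
by rewrite -(eqn_add2l (k - i)) h subnK.
Qed.

(** Both sides are the same sum with indices shifted by one; the hypotheses kill the two end
    terms. *)
Lemma string_sum_comm (s : F) (A : R) :
    N ^+ k.+1 * A = 0 -> A * N ^+ k.+1 = 0 ->
  s *: (N * string_sum s A) = string_sum s A * N.
Proof.
move=> NA AN; pose a i := s ^+ i *: (N ^+ i * A * N ^+ (k.+1 - i)).
transitivity (\sum_(i < k.+1) a i.+1).
  rewrite mulr_sumr scaler_sumr; apply: eq_bigr => i _.
  by rewrite /a subSS -scalerAr scalerA -exprS !mulrA -exprS.
rewrite mulr_suml; transitivity (\sum_(i < k.+1) a i).
  have a0 : a 0%N = 0 by rewrite /a mul1r subn0 AN scaler0.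
  have ak : a k.+1 = 0 by rewrite /a NA mul0r scaler0.
  transitivity (\sum_(i < k.+2) a i); first by rewrite [RHS]big_ord_recl a0 add0r.
  by rewrite big_ord_recr /= ak addr0.
apply: eq_bigr => i _; rewrite /a -scalerAl -!mulrA -exprSr subSn //.
by rewrite -ltnS.
Qed.

Lemma string_sum_bottom (A : R) :
  A * N ^+ k.+1 = 0 -> string_sum 1 A * N ^+ k = N ^+ k * A * N ^+ k.
Proof.
move=> AN; rewrite /string_sum big_ord_recr /= mulrDl mulr_suml.
rewrite big1 => [|i _]; first by rewrite add0r subnn expr1n scale1r mulr1.
rewrite -scalerAl -!mulrA -exprD.
have -> : (k - i + k = k.+1 + (k - i.+1))%N.
  by rewrite -{1}(subnSK (ltn_ord i)) !addSn addnC.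
by rewrite exprD !mulrA -[_ * A * _]mulrA AN mulr0 !mul0r scaler0.
Qed.

End Strings.

(** * Adjoints for a nondegenerate alternating form *)

Section Adjoint.
Variables (F : closedFieldType) (m : nat) (J : 'M[F]_m.+1).
Hypotheses (two_neq0 : (2%:R : F) != 0) (J_unit : J \in unitmx).
Hypothesis (JT : J^T = - J).

Definition adjoint (A : 'M[F]_m.+1) : 'M[F]_m.+1 := invmx J *m A^T *m J.

Lemma adjointD A B : adjoint (A + B) = adjoint A + adjoint B.
Proof. by rewrite /adjoint linearD /= mulmxDr mulmxDl. Qed.

Lemma adjointZ c A : adjoint (c *: A) = c *: adjoint A.
Proof. by rewrite /adjoint linearZ /= -scalemxAr -scalemxAl. Qed.

HB.instance Definition _ := GRing.isLinear.Build F _ _ _ adjoint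
  (fun c A B => etrans (adjointD _ _) (congr1 (+%R^~ _) (adjointZ c A))).

Lemma adjointM A B : adjoint (A * B) = adjoint B * adjoint A.
Proof.
by rewrite /adjoint -!mulmxE trmx_mul !mulmxA mulmxK.
Qed.

Lemma adjoint1 : adjoint 1 = 1.
Proof. by rewrite /adjoint trmx1 mulmx1 mulVmx. Qed.

Lemma adjointK A : adjoint (adjoint A) = A.
Proof.
rewrite /adjoint !trmx_mul trmxK trmx_inv JT !mulmxA.
have -> : invmx (- J) = - invmx J.
  by rewrite -scaleN1r invmxZ ?unitmxZ ?unitrN1 // invrN1 scaleN1r.
by rewrite !mulmxN !mulNmx opprK mulVmx // mul1mx -mulmxA mulVmx // mulmx1.
Qed.

Lemma adjointX A k : adjoint (A ^+ k) = adjoint A ^+ k.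
Proof.
elim: k => [|k IH]; first by rewrite !expr0 adjoint1.
by rewrite exprS adjointM IH -exprSr.
Qed.

Lemma adjoint_horner A p :
  adjoint A = A -> adjoint (horner_mx A p) = horner_mx A p.
Proof.
move=> hA; elim/poly_ind: p => [|p c IH]; first by rewrite !rmorph0 linear0.
rewrite rmorphD rmorphM /= horner_mx_X horner_mx_C linearD /= adjointM IH hA.
rewrite -[c%:M]scalemx1 linearZ /= adjoint1.
by congr (_ + _); apply: comm_mx_horner.
Qed.

Definition dual (v : 'cV[F]_m.+1) : 'rV[F]_m.+1 := v^T *m J.

Lemma adjoint_rank1 u v : adjoint (u *m dual v) = - (v *m dual u).
Proof.
rewrite /adjoint /dual !trmx_mul trmxK JT !mulNmx mulmxN mulNmx.
by rewrite !mulmxA mulVmx // mul1mx.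
Qed.

Lemma dual_mulmx A v : adjoint A = A -> dual (A *m v) = dual v *m A.
Proof.
by move=> hA; rewrite -{2}hA /dual /adjoint trmx_mul !mulmxA mulmxK.
Qed.

Lemma dual_skew A u v : adjoint A = A -> dual u *m A *m v = - (dual v *m A *m u).
Proof.
move=> hA; have -> : dual u *m A *m v = (dual u *m A *m v)^T.
  by rewrite [in RHS](mx11_scalar (_ *m v)) tr_scalar_mx -mx11_scalar.
rewrite -dual_mulmx // /dual !trmx_mul trmxK JT mulNmx mulmxN -mulmxA.
by rewrite trmxK !mulmxA.
Qed.

(** With powers of a self-adjoint [X] for [A], this makes the span of the [X^i v] isotropic. *)
Lemma dual_alt A v : adjoint A = A -> dual v *m A *m v = 0.
Proof.
move=> hA; have /eqP := dual_skew v v hA.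
by rewrite -addr_eq0 -mulr2n -scaler_nat scaler_eq0 (negPf two_neq0) => /eqP.
Qed.

(** * Self-adjoint projections and the nilpotent part *)

Definition selfadj_proj (X E : 'M[F]_m.+1) :=
  [/\ adjoint E = E, E * E = E & E * X = X * E].

(** [h] vanishes on the kernel of [E], so solutions on orthogonal summands can be added. On the
    image of [E], a self-adjoint involution is symplectic, since [adjoint h * h = h * h = E]. *)
Definition anti_involution (X E h : 'M[F]_m.+1) :=
  [/\ adjoint h = h, h * h = E, h * E = h, E * h = h & h * X = - (X * h)].

Lemma anti_involutionD X E1 E2 h1 h2 :
    E1 * E2 = 0 -> E2 * E1 = 0 ->
    anti_involution X E1 h1 -> anti_involution X E2 h2 ->
  anti_involution X (E1 + E2) (h1 + h2).
Proof.
move=> E12 E21 [a1 s1 r1 l1 c1] [a2 s2 r2 l2 c2].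
have h12 : h1 * h2 = 0 by rewrite -r1 -l2 -mulrA (mulrA E1) E12 mul0r mulr0.
have h21 : h2 * h1 = 0 by rewrite -r2 -l1 -mulrA (mulrA E2) E21 mul0r mulr0.
have hE12 : h1 * E2 = 0 by rewrite -s2 mulrA h12 mul0r.
have hE21 : h2 * E1 = 0 by rewrite -s1 mulrA h21 mul0r.
have Eh12 : E1 * h2 = 0 by rewrite -s1 -mulrA h12 mulr0.
have Eh21 : E2 * h1 = 0 by rewrite -s2 -mulrA h21 mulr0.
split; first by rewrite linearD /= a1 a2.
- by rewrite mulrDl !mulrDr h12 h21 s1 s2 addr0 add0r.
- by rewrite mulrDl !mulrDr hE12 hE21 r1 r2 addr0 add0r.
- by rewrite mulrDl !mulrDr Eh12 Eh21 l1 l2 addr0 add0r.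
- by rewrite mulrDl mulrDr c1 c2 opprD.
Qed.

Lemma string_vectors X E k :
    adjoint X = X -> selfadj_proj X E -> E * X ^+ k.+1 = 0 -> E * X ^+ k != 0 ->
  exists u v, [/\ E *m u = u, E *m v = v &
    forall j, dual v *m X ^+ j *m u = if j == k then 1%:M else 0].
Proof.
move=> hX [hE EE EX] Ek1 Ek.
have EXj j : E * X ^+ j = X ^+ j * E by apply: commrX.
have hXj j : adjoint (X ^+ j) = X ^+ j by rewrite adjointX hX.
have [u [v [Eu Ev uv]]] : exists u v,
    [/\ E *m u = u, E *m v = v & dual v *m X ^+ k *m u = 1%:M].
  have /matrix0Pn[i [j]] : J *m (E * X ^+ k) != 0.
    by apply: contraNneq Ek => /(congr1 (mulmx (invmx J)));
    rewrite mulKmx // mulmx0 => ->.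
  set c := (_ i j) => c0.
  have cE : dual (delta_mx i 0) *m E *m X ^+ k *m delta_mx j 0 = c%:M.
    rewrite /dual trmx_delta -!mulmxA (mulmxA E) (mulmxA J) -colE -rowE.
    by rewrite [LHS]mx11_scalar; congr _%:M; rewrite 2!mxE.
  have EXE : E *m X ^+ k *m E = E *m X ^+ k.
    by rewrite !mulmxE -mulrA -EXj mulrA EE.
  (* Basis vectors at a nonzero entry [c] of the form's matrix, projected by [E] and scaled to pair
     to 1. *)
  exists (E *m delta_mx j 0), (c^-1 *: (E *m delta_mx i 0)).
  rewrite -scalemxAr !(mulmxA E E) !mulmxE EE; split=> //.
  rewrite /dual linearZ /= -!scalemxAl -/(dual _) dual_mulmx // -!mulmxA.
  rewrite (mulmxA E) (mulmxA (E *m _)) EXE !mulmxA cE.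
  by rewrite scale_scalar_mx mulVf.
have Xu j : (k < j)%N -> X ^+ j *m u = 0.
  move=> kj; rewrite -Eu mulmxA mulmxE -EXj -(subnKC kj) exprD mulrA Ek1.
  by rewrite mul0r mul0mx.
(* The vacuous guard [k <= j + k] prepares the induction: its last [k] becomes a counter [i], and
   stage [i] has cleared the exponents [j] with [k - i <= j < k]. *)
suff [w [Ew wu wj]] : exists w, [/\ E *m w = w, dual w *m X ^+ k *m u = 1%:M &
    forall j, (j < k)%N -> (k <= j + k)%N -> dual w *m X ^+ j *m u = 0].
  exists u, w; split=> // j; case: ltngtP => [jk|kj|->] //.
    by rewrite wj // leq_addl.
  by rewrite -mulmxA Xu // mulmx0.
(* Subtracting a multiple of [X^(i+1) w] from [w] clears its pairing with
   [X^(k-i-1) u] and leaves the pairings with higher powers unchanged. *)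
elim: {1 6}k (leqnn k) => [|i IH] ik.
  by exists v; split=> // j jk; rewrite addn0 leqNgt jk.
have {IH} [w [Ew wu wj]] := IH (ltnW ik).
pose c := (dual w *m X ^+ (k - i.+1) *m u) 0 0.
exists (w - c *: (X ^+ i.+1 *m w)).
have dualE j : dual (w - c *: (X ^+ i.+1 *m w)) *m X ^+ j *m u
   = dual w *m X ^+ j *m u - c *: (dual w *m (X ^+ (i.+1 + j) *m u)).
  rewrite {1}/dual linearB linearZ /= mulmxBl -scalemxAl -/(dual w) -/(dual _).
  rewrite dual_mulmx // !mulmxBl -!scalemxAl; congr (_ - _ *: _).
  by rewrite exprD -mulmxE !mulmxA.
split.
- by rewrite mulmxBr -scalemxAr mulmxA mulmxE EXj -mulmxE -mulmxA !Ew.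
- by rewrite dualE Xu ?mulmx0 ?scaler0 ?subr0 // addSn ltnS leq_addl.
move=> j jk; rewrite addnS leq_eqVlt => /orP[/eqP kE|kj]; rewrite dualE.
  have ijk : (i.+1 + j = k)%N by rewrite kE addSn addnC.
  rewrite ijk mulmxA wu [X in X - _]mx11_scalar.
  have -> : (j = k - i.+1)%N by rewrite -ijk addKn.
  by rewrite scale_scalar_mx mulr1 subrr.
by rewrite wj // Xu ?mulmx0 ?scaler0 ?subr0 // addSn addnC.
Qed.

(** The adjoint reverses the string, [i] becoming [k - i], and [s^(k-i) = s^k s^i] when
    [s^2 = 1]. *)
Lemma adjoint_string_sum X k s A : adjoint X = X -> s ^+ 2 = 1 ->
  adjoint (string_sum X k s A) = string_sum X k s (s ^+ k *: adjoint A).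
Proof.
move=> hX s2; have sB a b : (a <= b)%N -> s ^+ (b - a) = s ^+ a * s ^+ b.
  move=> ab; rewrite -{2}(subnK ab) exprD mulrCA -expr2 -exprM mulnC exprM s2.
  by rewrite expr1n mulr1.
rewrite /string_sum linear_sum (reindex_inj rev_ord_inj) /=.
apply: eq_bigr => i _; have ik : (i <= k)%N by rewrite -ltnS.
rewrite linearZ /= !adjointM !adjointX hX subSS subKn // mulrA.
rewrite -scalerAr -scalerAl scalerA; congr (_ *: _).
exact: sB.
Qed.

Lemma rank1_sandwich (u w : 'cV[F]_m.+1) (a b : 'rV[F]_m.+1) (Y : 'M[F]_m.+1) :
  (u *m a) * Y * (w *m b) = u *m (a *m Y *m w) *m b.
Proof. by rewrite -!mulmxE !mulmxA. Qed.

(* The Jordan blocks of [u] and [v] are put in duality by the form; [h] acts on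
   them as [X^i u -> (-1)^i X^i u] and [X^i v -> (-1)^(k+i) X^i v]. *)
Lemma string_anti_involution X E k :
    adjoint X = X -> selfadj_proj X E -> E * X ^+ k.+1 = 0 -> E * X ^+ k != 0 ->
  exists E1 h, [/\ E1 != 0, selfadj_proj X E1, E * E1 = E1, E1 * E = E1 &
    anti_involution X E1 h].
Proof.
move=> hX hE Ek1 Ek.
have [u [v [Eu Ev uv]]] := string_vectors hX hE Ek1 Ek.
have {hE} [hE EE EX] := hE.
have hXj j : adjoint (X ^+ j) = X ^+ j by rewrite adjointX hX.
have Euv w : E *m w = w -> dual w *m E = dual w.
  by move=> Ew; rewrite -dual_mulmx // Ew.
have XE j : X ^+ j * E = E * X ^+ j by apply/esym/commrX.
pose P := u *m dual v; pose Q := - (v *m dual u).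
have aP : adjoint P = Q by rewrite adjoint_rank1.
have aQ : adjoint Q = P by rewrite -aP adjointK.
have EP : E * P = P by rewrite -mulmxE mulmxA Eu.
have PE : P * E = P by rewrite -mulmxE -mulmxA Euv.
have EQ : E * Q = Q by rewrite -aP -[in RHS]PE adjointM hE.
have QE : Q * E = Q by rewrite -aP -[in RHS]EP adjointM hE.
have PP j : P * X ^+ j * P = if j == k then P else 0.
  rewrite rank1_sandwich uv.
  by case: eqP; rewrite ?mulmx1 ?mulmx0 ?mul0mx.
have QQ j : Q * X ^+ j * Q = if j == k then Q else 0.
  have := congr1 adjoint (PP j); rewrite !adjointM hXj aP mulrA => ->.
  by case: eqP; rewrite ?linear0.
have PQ j : P * X ^+ j * Q = 0.
  by rewrite mulrN rank1_sandwich dual_alt // mulmx0 mul0mx oppr0.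
have QP j : Q * X ^+ j * P = 0.
  by rewrite !mulNr rank1_sandwich dual_alt // mulmx0 mul0mx oppr0.
pose A (c : F) := P + c *: Q.
have AA c d j : A c * X ^+ j * A d = if j == k then A (c * d) else 0.
  rewrite /A !mulrDl !mulrDr -!scalerAl -!scalerAr PP PQ QP QQ !scaler0 addr0 add0r.
  by case: eqP; rewrite ?scaler0 ?addr0 // scalerA.
have EA c : E * A c = A c by rewrite /A mulrDr -scalerAr EP EQ.
have AE c : A c * E = A c by rewrite /A mulrDl -scalerAl PE QE.
have XA c : X ^+ k.+1 * A c = 0 by rewrite -EA mulrA XE Ek1 mul0r.
have AX c : A c * X ^+ k.+1 = 0 by rewrite -AE -mulrA Ek1 mulr0.
pose T s c := string_sum X k s (A c).
have TT s s' c d : T s c * T s' d = T (s * s') (c * d).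
  by apply: string_sumM => j; apply: AA.
have TX s c : s *: (X * T s c) = T s c * X by apply: string_sum_comm.
have ET s c : E * T s c = T s c.
  rewrite /T /string_sum mulr_sumr; apply: eq_bigr => i _.
  by rewrite -scalerAr !mulrA -XE -(mulrA _ E) EA.
have TE s c : T s c * E = T s c.
  rewrite /T /string_sum mulr_suml; apply: eq_bigr => i _.
  by rewrite -scalerAl -!mulrA XE (mulrA (A c)) AE.
have aA c : c ^+ 2 = 1 -> c *: adjoint (A c) = A c.
  move=> c2; rewrite /A linearD linearZ /= aP aQ scalerDr scalerA -expr2 c2.
  by rewrite scale1r addrC.
(* This sign on the second string cancels the factor [s^k] that the adjoint produces for
   [s = -1]. *)
pose e : F := (-1) ^+ k.
have e2 : e ^+ 2 = 1 by rewrite -exprM mulnC exprM sqrrN expr1n expr1n.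
exists (T 1 1), (T (-1) e); split; last 4 first.
- split; last by rewrite -TX scale1r.
    by rewrite adjoint_string_sum ?expr1n // -{2}(expr1n _ k) expr1n aA ?expr1n.
  by rewrite TT !mulr1.
- exact: ET.
- exact: TE.
- split; rewrite ?TT ?mulr1 ?mul1r // -?expr2 ?sqrrN ?expr1n ?e2 //.
    by rewrite adjoint_string_sum ?sqrrN ?expr1n // aA.
  by rewrite -TX scaleN1r.
(* If the projection were 0, then [X^k P = 0]; but pairing [X^k P X^k u] with [v] gives 1. *)
apply/eqP => T0.
have XP : X ^+ k * P = 0.
  rewrite -[RHS](mul0r (X ^+ k * P)) -T0 mulrA string_sum_bottom // -!mulrA.
  rewrite (mulrA (A 1)) /A mulrDl mulrDl scale1r PP QP eqxx addr0 //.
have := congr1 (fun Y => dual v *m Y *m (X ^+ k *m u)) XP.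
rewrite mulmx0 mul0mx -mulmxE /P !mulmxA uv eqxx mul1mx uv eqxx.
by move/matrixP/(_ 0 0)/eqP; rewrite !mxE oner_eq0.
Qed.

(** Induction on the rank of [E]: the least exponent that kills gives a longest string, and removing
    its projection [E1] leaves the self-adjoint projection [E - E1] of smaller rank. *)
Lemma nilpotent_anti_involution X E k :
    adjoint X = X -> selfadj_proj X E -> E * X ^+ k = 0 ->
  exists h, anti_involution X E h.
Proof.
move=> hX; have [r] := ubnP (\rank E); elim: r E => // r IH E rE pE Ek.
have [E0|E0] := eqVneq E 0.
  by exists 0; rewrite E0; split; rewrite ?(linear0, mul0r, mulr0, oppr0).
have [hE EE EX] := pE.
have ex : exists k, E * X ^+ k == 0 by exists k; apply/eqP.
case: (ex_minnP ex) => [[|k'] /eqP Ek' kmin].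
  by rewrite mulr1 in Ek'; case/eqP: E0.
have [|E1 [h1 [E10 pE1 EE1 E1E hh1]]] := string_anti_involution hX pE Ek'.
  by apply/negP=> /kmin; rewrite ltnn.
have [hE1 EE1' EX1] := pE1.
have [|||h2 hh2] := IH (E - E1).
- rewrite -ltnS (leq_trans _ rE) // ltnS; apply: rank_ltmx.
  have sub : (E - E1 <= E)%MS.
    apply/submxP; exists (E - E1).
    by rewrite mulmxE mulrBl EE E1E.
  rewrite /ltmx sub /=; apply: contra E10 => /submxP[D ED]; apply/eqP.
  by rewrite -EE1 ED mulmxE -mulrA mulrBl EE1 EE1' subrr mulr0.
- split; first by rewrite linearB /= hE hE1.
    by rewrite mulrBl !mulrBr EE EE1 E1E EE1' subrr subr0.
  by rewrite mulrBl mulrBr EX EX1.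
- by rewrite mulrBl Ek -E1E -mulrA Ek mulr0 subr0.
exists (h1 + h2); have -> : E = E1 + (E - E1) by rewrite addrC subrK.
apply: anti_involutionD => //.
  by rewrite mulrBr E1E EE1' subrr.
by rewrite mulrBl EE1 EE1' subrr.
Qed.

(** * Polar decomposition and the invertible part *)

Lemma inverse_sqrt_mx (M : 'M[F]_m.+1) : M \in unitmx ->
  exists t, M * horner_mx M t ^+ 2 = 1.
Proof.
move=> Mu; have [|t /dvdpP[r hr]] := inverse_sqrt_mod two_neq0 (p := char_poly M).
  rewrite /root horner_coef0 char_poly_det mulf_neq0 ?signr_eq0 //.
  by rewrite -unitfE -unitmxE.
exists t; have := congr1 (horner_mx M) hr.
rewrite rmorphM /= Cayley_Hamilton mulr0 rmorphB rmorphM rmorphXn rmorph1 /=.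
by rewrite horner_mx_X => /eqP; rewrite subr_eq0 => /eqP.
Qed.

(* Polar decomposition: [adjoint g * g] commutes with [X], hence so does its
   inverse square root [t], and [g * t] is symplectic. *)
Lemma anti_isometry X g : adjoint X = X -> g \in unitmx -> g * X = - (X * g) ->
  exists h, adjoint h * h = 1 /\ h * X = - (X * h).
Proof.
move=> hX gu gX.
have agX : adjoint g * X = - (X * adjoint g).
  by rewrite -{1}hX -adjointM -[X * g]opprK -gX linearN /= adjointM hX.
pose M := adjoint g * g.
have MX : M * X = X * M.
  by rewrite /M -[LHS]mulrA gX mulrN [X in - X]mulrA agX mulNr opprK -mulrA.
have hM : adjoint M = M by rewrite /M adjointM adjointK.
have Mu : M \in unitmx.
  by rewrite !unitmx_mul unitmx_inv unitmx_tr J_unit gu.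
have [t ht] := inverse_sqrt_mx Mu.
have tM : horner_mx M t * M = M * horner_mx M t by apply: comm_horner_mx.
have tX : horner_mx M t * X = X * horner_mx M t by apply: comm_horner_mx.
exists (g * horner_mx M t); split.
  rewrite adjointM adjoint_horner // -mulrA (mulrA (adjoint g)) -/M mulrA tM.
  by rewrite -mulrA -expr2.
by rewrite -mulrA tX mulrA gX mulNr mulrA.
Qed.

(** Write the characteristic polynomial as [q X^n] with [q(0)] nonzero. A Bezout relation between
    [q] and [X^n] gives the idempotents, and [t] is an inverse square root modulo [q]. *)
Lemma spectral_sign_polys (Y : 'M[F]_m.+1) : exists e0 e1 t n,
  [/\ horner_mx Y e0 + horner_mx Y e1 = 1, horner_mx Y e0 * horner_mx Y e1 = 0,
      horner_mx Y e0 * Y ^+ n = 0 &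
      Y * horner_mx Y t ^+ 2 * horner_mx Y e1 = horner_mx Y e1].
Proof.
have char0 : char_poly Y != 0 by rewrite monic_neq0 // char_poly_monic.
have [n [q]] := multiplicity_XsubC (char_poly Y) 0.
rewrite char0 /= subr0 => q0 qE.
have qY : horner_mx Y q * Y ^+ n = 0.
  by rewrite -[Y in Y ^+ n]horner_mx_X -rmorphXn -rmorphM /= -qE Cayley_Hamilton.
have [t /dvdpP[r tr]] := inverse_sqrt_mod two_neq0 q0.
have cop : coprimep q ('X ^+ n).
  by rewrite coprimep_expr // -['X]subr0 coprimep_XsubC.
have /Bezout_eq1_coprimepP[[u v] /= uv] := cop.
have Yn : horner_mx Y ('X ^+ n) = Y ^+ n by rewrite rmorphXn /= horner_mx_X.
have vq : horner_mx Y (v * 'X^n) * horner_mx Y q = 0.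
  by rewrite -rmorphM /= -mulrA ['X^n * _]mulrC !rmorphM /= Yn qY mulr0.
move: (v * 'X^n) uv vq => w uv wq; exists (u * q), w, t, n; split.
- by rewrite -rmorphD /= uv rmorph1.
- by rewrite -rmorphM /= mulrC [u * q]mulrC mulrA 2!rmorphM /= wq mul0r.
- by rewrite rmorphM /= -mulrA qY mulr0.
apply/eqP; rewrite -subr_eq0 -[X in _ - X]mul1r -mulrBl.
have -> : Y * horner_mx Y t ^+ 2 - 1 = horner_mx Y (r * q).
  by rewrite -tr rmorphB rmorphM rmorphXn rmorph1 /= horner_mx_X.
by rewrite -rmorphM /= -mulrA [q * _]mulrC 2!rmorphM /= wq mulr0.
Qed.

Lemma adjoint_anti_involution X g : adjoint X = X -> g \in unitmx ->
  g * X = - (X * g) -> exists h, anti_involution X 1 h.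
Proof.
move=> hX gu gX; have [h [ahh hXN]] := anti_isometry hX gu gX.
have hah : h * adjoint h = 1 by exact: mulmx1C.
have ahX : adjoint h * X = - (X * adjoint h).
  by rewrite -{1}hX -adjointM -[X * h]opprK -hXN linearN /= adjointM hX.
(* Whatever anticommutes with [X] commutes with every polynomial in [X^2]. *)
pose Y := X ^+ 2.
have hY : adjoint Y = Y by rewrite adjointX hX.
have [e0 [e1 [t [n [e01 e0e1 e0n te]]]]] := spectral_sign_polys Y.
set E0 := horner_mx Y e0 in e01 e0e1 e0n.
set E1 := horner_mx Y e1 in e01 e0e1 te.
set s := horner_mx Y t in te.
have YX : Y * X = X * Y by rewrite -exprSr -exprS.
have polyX p : horner_mx Y p * X = X * horner_mx Y p by apply: comm_horner_mx.
have anti_poly a p : a * X = - (X * a) -> a * horner_mx Y p = horner_mx Y p * a.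
  move=> aX; apply: comm_mx_horner; rewrite /comm_mx !mulmxE.
  by rewrite /Y expr2 mulrA aX mulNr -mulrA aX mulrN opprK mulrA.
have polyC p q : horner_mx Y p * horner_mx Y q = horner_mx Y q * horner_mx Y p.
  by rewrite -!rmorphM /= mulrC.
have aP p : adjoint (horner_mx Y p) = horner_mx Y p by apply: adjoint_horner.
have e1e0 : E1 * E0 = 0 by rewrite /E1 polyC.
have sC : s * E1 = E1 * s by apply: polyC.
have sX : s * X = X * s by apply: polyX.
have E1X : E1 * X = X * E1 by apply: polyX.
have E0X : E0 * X = X * E0 by apply: polyX.
have [aE0 aE1 aS] : [/\ adjoint E0 = E0, adjoint E1 = E1 & adjoint s = s].
  by split; apply: aP.
have anti_E1 a : a * X = - (X * a) -> a * E1 = E1 * a by apply: anti_poly.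
have anti_s a : a * X = - (X * a) -> a * s = s * a by apply: anti_poly.
clearbody E0 E1 s.
have E00 : E0 * E0 = E0 by rewrite -[RHS]mulr1 -e01 mulrDr e0e1 addr0.
have E11 : E1 * E1 = E1 by rewrite -[RHS]mulr1 -e01 mulrDr e1e0 add0r.
have [||h0 hh0] := nilpotent_anti_involution (E := E0) (k := (2 * n)%N) hX.
- by split.
- by rewrite exprM.
suff [h1 hh1] : exists h1, anti_involution X E1 h1.
  by exists (h0 + h1); rewrite -e01; apply: anti_involutionD.
pose f := X * s * E1.
have fE1 : f * E1 = f by rewrite /f -mulrA E11.
have fX : f * X = X * f by rewrite /f -mulrA E1X mulrA -(mulrA X) sX !mulrA.
have E1f : E1 * f = f.
  have -> : f = E1 * (X * s) by rewrite mulrA E1X -mulrA -sC mulrA.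
  by rewrite mulrA E11.
have ff : f * f = E1.
  have sE1 : s * E1 * (s * E1) = s ^+ 2 * E1.
    by rewrite -mulrA (mulrA E1) -sC -mulrA E11 mulrA expr2.
  have sE1X : s * E1 * X = X * (s * E1) by rewrite -mulrA E1X mulrA sX mulrA.
  rewrite /f -(mulrA X) mulrA -(mulrA X) sE1X (mulrA X) -expr2 -mulrA sE1.
  by rewrite mulrA te.
have af : adjoint f = f.
  by rewrite /f !adjointM aE1 aS hX sX mulrA E1X -mulrA -sC mulrA.
have anti_f a : a * X = - (X * a) -> a * f = - (f * a).
  move=> aX; rewrite /f !mulrA aX !mulNr -!mulrA -anti_E1 //.
  by rewrite (mulrA a s) (mulrA s a) anti_s.
pose b : F := 2%:R^-1.
have bb : b + b = 1 by rewrite -mulr2n -mulr_natl mulfV.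
(* The eigenprojections of [f], exchanged by [h]. *)
pose Ep := b *: (E1 + f); pose Em := b *: (E1 - f).
have EpEm : Ep + Em = E1.
  by rewrite -scalerDr addrACA subrr addr0 scalerDr -scalerDl bb scale1r.
have Epm : Ep * Em = 0.
  rewrite -scalerAl -scalerAr mulrDl !mulrBr E11 fE1 ff E1f addrA subrK subrr.
  by rewrite !scaler0.
have Emp : Em * Ep = 0.
  rewrite -scalerAl -scalerAr mulrBl !mulrDr E11 fE1 ff E1f opprD addrA addrK subrr.
  by rewrite !scaler0.
have E1Ep : E1 * Ep = Ep by rewrite -scalerAr mulrDr E11 E1f.
have E1Em : E1 * Em = Em by rewrite -scalerAr mulrBr E11 E1f.
have EpE1 : Ep * E1 = Ep by rewrite -scalerAl mulrDl E11 fE1.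
have EmE1 : Em * E1 = Em by rewrite -scalerAl mulrBl E11 fE1.
have Epp : Ep * Ep = Ep by rewrite -[RHS]EpE1 -EpEm mulrDr Epm addr0.
have Emm : Em * Em = Em by rewrite -[RHS]EmE1 -EpEm mulrDr Emp add0r.
have swap a : a * X = - (X * a) -> a * Ep = Em * a /\ a * Em = Ep * a.
  move=> aX; rewrite -!scalerAl -!scalerAr !mulrDr !mulrDl mulrN mulNr.
  by rewrite anti_E1 // anti_f // opprK.
have [hEp hEm] := swap _ hXN; have [aEp aEm] := swap _ ahX.
have aEp' : adjoint Ep = Ep by rewrite linearZ linearD /= af aE1.
have aEm' : adjoint Em = Em by rewrite linearZ linearB /= af aE1.
have EpX : Ep * X = X * Ep by rewrite -scalerAl -scalerAr mulrDl mulrDr fX E1X.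
have EmX : Em * X = X * Em by rewrite -scalerAl -scalerAr mulrBl mulrBr fX E1X.
(* Here [adjoint h] is the inverse of [h]. The adjoint swaps the two terms, as
   [Ep * adjoint h = adjoint h * Em]; in the square, [h] goes from one eigenspace to the other and
   its inverse goes back. *)
exists (h * Ep + adjoint h * Em); split.
- rewrite linearD /= (adjointM h) (adjointM (adjoint h)) adjointK.
  by rewrite aEp' aEm' -aEm -hEp addrC.
- have mid (x y z w : 'M[F]_m.+1) : x * y * (z * w) = x * (y * z) * w.
    by rewrite !mulrA.
  move: (adjoint h) hah ahh aEp aEm => a hah ahh aEp aEm.
  rewrite mulrDl !mulrDr !mid -hEm -aEm -hEp -aEp !mulrA hah ahh !mul1r.
  rewrite -(mulrA _ Em Ep) -(mulrA _ Ep Em) Emp Epm.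
  by rewrite !mulr0 add0r addr0 Emm Epp addrC.
- by rewrite mulrDl -!mulrA EpE1 EmE1.
- by rewrite mulrDr hEp aEm !mulrA E1Ep E1Em.
- move: (adjoint h) ahX => a aX.
  by rewrite mulrDl mulrDr -!mulrA EpX EmX !mulrA hXN aX !mulNr opprD.
Qed.

End Adjoint.

(** * The standard symplectic form over the complex numbers *)

Theorem theorem1p5 (R : realType) (n : nat) (n_ge1 : (1 <= n)%N)
    (X : 'M[R[i]]_(n + n)) (X_SH : X \in skewHamiltonian R[i] n) :
  (exists2 g : 'M[R[i]]_(n + n),
      g \in unitmx & g *m X *m invmx g = - X)
  <->
  (exists h : 'M[R[i]]_(n + n),
      [/\ h \in Sp R[i] n, h *m h = 1%:M & h *m X *m invmx h = - X]).
Proof.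
split; last first.
  by case=> h [/andP[hu _] _ hX]; exists h.
case=> g gu gX.
have two_neq0 : (2%:R : R[i]) != 0 by rewrite Num.Theory.pnatr_eq0.
have JT : (Jmx R[i] n)^T = - Jmx R[i] n.
  by rewrite /Jmx tr_block_mx opp_block_mx !trmx0 linearN /= trmx1 opprK !oppr0.
have JJ : Jmx R[i] n *m - Jmx R[i] n = 1%:M.
  rewrite /Jmx mulmxN mulmx_block opp_block_mx.
  rewrite !(mul0mx, mulmx0, mulmx1, mul1mx, add0r, addr0, oppr0, opprK).
  by rewrite -scalar_mx_block.
have Ju : Jmx R[i] n \in unitmx by case/mulmx1_unit: JJ.
move: X_SH => /eqP.
have {gX} gX : g *m X = - (X *m g) by rewrite -mulNmx -gX mulmxKV.
(* Matrices form a nonzero ring only in positive size, which [n_ge1] ensures. *)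
case: n n_ge1 X g gu gX JT JJ Ju => // n _ X g gu gX JT JJ Ju X_SH.
have hX : adjoint (Jmx R[i] n.+1) X = X by rewrite /adjoint -mulmxA X_SH mulKmx.
have [h [ah hh _ _ hX']] := adjoint_anti_involution two_neq0 Ju JT hX gu gX.
have hu : h \in unitmx by case/mulmx1_unit: hh.
exists h; split=> //; last by rewrite mulmxE hX' -mulmxE mulNmx mulmxK.
apply/andP; split=> //; apply/eqP.
have hJ : adjoint (Jmx R[i] n.+1) h *m h = 1%:M by rewrite ah.
by rewrite -[RHS]mulmx1 -hJ /adjoint !mulmxA mulmxV // mul1mx.
Qed.
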